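(* Let $0<q<1$, let $a,b$ be real with $0<a<q^{-1}$ and $b<q^{-1}$, and let $v\in\mathbb{C}$. Define $$K=\begin{pmatrix}0&v(1-q)(q^{-1}-a)\\0&0\end{pmatrix},\qquad A=\begin{pmatrix}q&-v(1-q)\\0&1\end{pmatrix}.$$ Let $(P_n)_{n\ge0}$ be the monic matrix-valued orthogonal polynomials with respect to $\langle\cdot,\cdot\rangle_W$ with weight matrix $W(q^x)=a^x\frac{(bq;q)_x}{(q;q)_x}A^x(A^* )^x$, $x\in\mathbb{N}$, let $\tilde P_n=N_nP_n$, and let $\tilde P_{i,n}$ be the $i$-th row of $\tilde P_n$, $i=1,2$. Put $\tilde\lambda_{1,n}=-q^{-n-1}-abq^{n+2}$ and $\tilde\lambda_{2,n}=-q^{-n}-abq^{n+1}$. Then the solution $\tilde P_{i,n}$ of $$\tilde P_{i,n}(q^{-1}z)(1-z)+\tilde P_{i,n}(z)\left(z(K-\tilde\lambda_{i,n}I)A-(I+aA^2)\right)+\tilde P_{i,n}(qz)\left((a-abqz)A^2\right)=0$$ is given by $$\tilde P_{i,n}(z)=\tilde P_{i,n}(0)\;{}_2\eta_1\biggl[\genfrac..{0pt}{}{KA-\tilde\lambda_{i,n}A,\ -abqA^2}{aA^2};q,qz\biggr],\qquad i=1,2,\ n\ge0.$$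
   Context: $\mathbb{N}=\{0,1,2,\dots\}$; $(c;q)_n=\prod_{i=0}^{n-1}(1-cq^i)$. The inner product is $\langle P,Q\rangle_W=\sum_{x=0}^\infty q^xP(q^x)W(q^x)Q(q^x)^*$ on polynomials with coefficients in $\mathrm{Mat}_2(\mathbb{C})$; the monic orthogonal polynomials are the unique sequence $(P_n)$ with $P_n$ of degree $n$, leading coefficient $I$, and $\langle P_m,P_n\rangle_W=0$ for $m\ne n$. Further $$N_n=\begin{pmatrix}1&\alpha_n\\0&1\end{pmatrix},\quad\alpha_n=v\,\frac{1-q^n+aq^{n+1}-abq^{2n+2}}{1-abq^{2n+2}}.$$ For matrices $X,Y,Z$ such that $Z$ has no eigenvalue in $\{q^{-n}:n\ge1\}$, set $(X,Y;Z;q)_0=I$, $(X,Y;Z;q)_k=(X,Y;Z;q)_{k-1}(I-q^{k-1}X-q^{2k-2}Y)(I-q^kZ)^{-1}$ for $k\ge1$, and $${}_2\eta_1\biggl[\genfrac..{0pt}{}{X,Y}{Z};q,z\biggr]=\sum_{n=0}^\infty(X,Y;Z;q)_n\frac{z^n}{(q;q)_n},$$ which converges for $|z|<1$. *)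

(* Defs.v *)
(* MathComp-Analysis over an arbitrary realType R; the complex numbers are the
   type R[i] of mathcomp.real_closed.complex. *)
From HB Require Import structures.
From mathcomp Require Import all_boot all_order all_algebra.
From mathcomp Require Import all_classical all_reals all_analysis.
From mathcomp Require Import complex.

Set Implicit Arguments.
Unset Strict Implicit.
Unset Printing Implicit Defensive.

Import Order.TTheory GRing.Theory Num.Theory.
Import numFieldNormedType.Exports.

Local Open Scope classical_set_scope.
Local Open Scope complex_scope.
Local Open Scope sesquilinear_scope.
Local Open Scope ring_scope.

(* The modulus topology on R[i]: the library only declares it for an abstract
   numClosedFieldType. Matrices over R[i] then inherit the entrywise topology,
   used below for all infinite sums. *)
#[export, non_forgetful_inheritance, warning="-redundant-canonical-projection"]
HB.instance Definition _ (R : realType) :=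
  NormedModule.copy R[i] (R[i] : numClosedFieldType)^o.

Definition qpoch (F : pzRingType) (c q : F) (n : nat) : F :=
  \prod_(i < n) (1 - c * q ^+ i).

Definition mx2 (F : Type) (x y z t : F) : 'M[F]_2 :=
  \matrix_(i < 2, j < 2)
    if i == ord0 then (if j == ord0 then x else y)
    else (if j == ord0 then z else t).

Section QSeries.
Variable R : realType.
Local Notation C := R[i].

(* (X, Y; Z; q)_k. The factors I - q^k Z are invertible exactly when no q^{-k},
   k >= 1, is an eigenvalue of Z; otherwise invmx returns a junk value. *)
Fixpoint eta_poch (X Y Z : 'M[C]_2) (q : C) (k : nat) : 'M[C]_2 :=
  if k is k'.+1 then
    eta_poch X Y Z q k' *m (1%:M - q ^+ k' *: X - q ^+ (2 * k') *: Y)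
      *m invmx (1%:M - q ^+ k *: Z)
  else 1%:M.

Definition eta21 (X Y Z : 'M[C]_2) (q z : C) : 'M[C]_2 :=
  limn (series (fun n => (z ^+ n / qpoch q q n) *: eta_poch X Y Z q n)).

(* A polynomial with matrix coefficients is evaluated at z by Horner evaluation
   at the (central) scalar matrix z I. *)
Definition peval (P : {poly 'M[C]_2}) (z : C) : 'M[C]_2 := P.[z%:M].

(* W x stands for W(q^x): only the values of the weight at q^x matter. *)
Definition qinner (q : R) (W : nat -> 'M[C]_2) (P Q : {poly 'M[C]_2}) :
    'M[C]_2 :=
  limn (series (fun x : nat => (q%:C ^+ x) *:
    (peval P (q%:C ^+ x) *m W x *m (peval Q (q%:C ^+ x)) ^t*))).

Definition monic_orthogonal (q : R) (W : nat -> 'M[C]_2)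
    (P : nat -> {poly 'M[C]_2}) : Prop :=
  (forall n, size (P n) = n.+1 /\ lead_coef (P n) = 1) /\
  (forall m n, m <> n -> qinner q W (P m) (P n) = 0).

Definition Amx (q : R) (v : C) : 'M[C]_2 :=
  mx2 q%:C (- v * (1 - q%:C)) 0 1.

Definition Kmx (q a : R) (v : C) : 'M[C]_2 :=
  mx2 0 (v * (1 - q%:C) * (q%:C^-1 - a%:C)) 0 0.

Definition weight (q a b : R) (v : C) (x : nat) : 'M[C]_2 :=
  (a ^+ x * (qpoch (b * q) q x / qpoch q q x))%:C *:
    (Amx q v ^+ x *m (Amx q v ^t*) ^+ x).

Definition alpha (q a b : R) (v : C) (n : nat) : C :=
  v * ((1 - q ^+ n + a * q ^+ n.+1 - a * b * q ^+ (2 * n + 2))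
       / (1 - a * b * q ^+ (2 * n + 2)))%:C.

Definition Nmx (q a b : R) (v : C) (n : nat) : 'M[C]_2 :=
  mx2 1 (alpha q a b v n) 0 1.

(* The index i : 'I_2 is shifted: ord0 is the first row. *)
Definition lambda (q a b : R) (i : 'I_2) (n : nat) : C :=
  (if i == ord0 then - q ^- n.+1 - a * b * q ^+ (n + 2)
   else - q ^- n - a * b * q ^+ n.+1)%:C.

Definition Ptilde (q a b : R) (v : C) (P : nat -> {poly 'M[C]_2}) (n : nat) :
    {poly 'M[C]_2} :=
  (Nmx q a b v n)%:P * P n.

Definition Ptilde_row (q a b : R) (v : C) (P : nat -> {poly 'M[C]_2})
    (i : 'I_2) (n : nat) (z : C) : 'rV[C]_2 :=
  row i (peval (Ptilde q a b v P n) z).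

End QSeries.

(* Main.v *)
Require Import Defs.
From HB Require Import structures.
From mathcomp Require Import all_boot all_order all_algebra.
From mathcomp Require Import all_classical all_reals all_analysis.
From mathcomp Require Import complex.
From mathcomp Require Import ring lra.

Set Implicit Arguments.
Unset Strict Implicit.
Unset Printing Implicit Defensive.

Import Order.TTheory GRing.Theory Num.Theory.
Import numFieldNormedType.Exports.

Local Open Scope complex_scope.
Local Open Scope sesquilinear_scope.
Local Open Scope classical_set_scope.
Local Open Scope ring_scope.

(** The rows of the polynomials N_n P_n are eigenfunctions of a second-order
q-difference operator D acting on the right, and the equation for the power
series coefficients of an eigenfunction is the two-term recurrence that defines
the series 2eta1.

The operator has coefficients (1/z - 1) A^-1, K - (A^-1 + a A)/z and
(a/z - a b q) A at z/q, z and q z. It maps polynomials to polynomials without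
raising the degree, and the coefficient of z^n in z^n D is the upper triangular
matrix Bcoef n ([peval_qdiff]).

D is symmetric for the inner product ([qdiff_sym]). Write the inner product as
a sum of scalar weights times g_x times the adjoint of h_x, where
g_x = P(q^x) A^x ([lat]). In these variables D has real scalar outer
coefficients and a constant real diagonal middle coefficient ([lat_qdiff]), and
the Pearson equation of the scalar weight ([cwtS]) makes the difference of the
two inner products telescope. The remaining boundary term tends to zero because
q^x times the scalar weight is summable while g_x and h_x are bounded with
increments O(q^x) ([bdry_cvg0]).

Hence P_n D - Bcoef n P_n has degree less than n and is orthogonal to itself,
and the inner product is definite ([qinner_eq0]), so P_n D = Bcoef n P_n
([qdiff_eigen]). The matrix N_n diagonalises Bcoef n, with eigenvalues
lambda_(1,n) and lambda_(2,n) ([Nmx_Bcoef]); multiplying row i of the eigenvalue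
equation by z A on the right gives the stated difference equation.

Comparing coefficients of z^k gives [row_recurrence], which expresses the k-th
coefficient of the row through its value at 0 and the Pochhammer symbol
([coef_eta]). The matrix series converges for |q z| < 1 ([eta_cvg]), so its
product with the value at 0 is the limit of the partial sums of a polynomial,
which are eventually constant. *)

(** * Real sequences *)

Section RealSeries.
Variable R : realType.
Implicit Types (u : nat -> R) (r : R).

(** Each of the finitely many exceptional indices costs only a larger constant,
hence the induction on N for the shifted sequence. *)
Lemma geometric_domination N u r : 0 < r ->
  (forall n, (N <= n)%N -> u n.+1 <= r * u n) ->
  exists C, forall n, u n <= C * r ^+ n.
Proof.
move=> r0; elim: N u => [|N IH] u hu.
  exists (u 0%N); elim=> [|n IHn]; first by rewrite expr0 mulr1.
  by rewrite (le_trans (hu n _))// exprS mulrCA ler_pM2l.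
have [|C hC] := IH (fun n => u n.+1); first by move=> n Nn; exact: hu.
exists (Num.max (u 0%N) (C / r)) => -[|n].
  by rewrite expr0 mulr1 le_max lexx.
apply: le_trans (hC n) _.
have -> : C * r ^+ n = C / r * r ^+ n.+1.
  by rewrite exprS mulrA divfK // gt_eqF.
by rewrite ler_pM2r ?exprn_gt0// le_max lexx orbT.
Qed.

Lemma ratio_test u r N : (forall n, 0 <= u n) -> 0 < r < 1 ->
  (forall n, (N <= n)%N -> u n.+1 <= r * u n) -> cvgn (series u).
Proof.
move=> u0 /andP[r0 r1] hu.
have [C hC] := geometric_domination r0 hu.
apply: (@series_le_cvg _ _ (geometric C r)) => //.
  by move=> n; exact: le_trans (u0 n) (hC n).
by apply: is_cvg_geometric_series; rewrite gtr0_norm.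
Qed.

Lemma exprn_eventually_lt r e : 0 <= r < 1 -> 0 < e ->
  exists N, forall n, (N <= n)%N -> r ^+ n < e.
Proof.
move=> /andP[r0 r1] e0.
have : (fun n => r ^+ n) @ \oo --> (0 : R).
  by apply: cvg_expr; rewrite ger0_norm.
move=> /cvgr0Pnorm_lt /(_ e e0) [N _ hN]; exists N => n Nn.
by have := hN n Nn; rewrite /= ger0_norm// exprn_ge0.
Qed.

Lemma cvg0D u w : u @ \oo --> (0 : R) -> w @ \oo --> (0 : R) ->
  (fun n => u n + w n) @ \oo --> (0 : R).
Proof. by move=> u0 w0; rewrite -[X in _ --> X](addr0 0); exact: cvgD. Qed.

Lemma cvg0Ml u c : u @ \oo --> (0 : R) -> (fun n => c * u n) @ \oo --> (0 : R).
Proof.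
by move=> u0; rewrite -[X in _ --> X](mulr0 c); apply: cvgM => //; exact: cvg_cst.
Qed.

Lemma cvg0_sum (I : finType) (F : I -> nat -> R) :
  (forall i, F i @ \oo --> (0 : R)) ->
  (fun n => \sum_i F i n) @ \oo --> (0 : R).
Proof.
move=> F0; elim: (index_enum I) => [|i s IH].
  by under eq_fun do rewrite big_nil; exact: cvg_cst.
by under eq_fun do rewrite big_cons; exact: cvg0D.
Qed.

Lemma squeeze0 u w : (forall n, 0 <= u n <= w n) ->
  w @ \oo --> (0 : R) -> u @ \oo --> (0 : R).
Proof.
by move=> uw w0; apply: (squeeze_cvgr _ (cvg_cst 0) w0); exact: nearW.
Qed.

End RealSeries.

(** * Convergence of complex matrices *)

Section MatrixConvergence.
Variable R : realType.
Local Notation C := R[i].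
Local Notation normc := (@ComplexField.Normc.normc R).

Lemma norm_normc (x : C) : `|x| = (normc x)%:C.
Proof. by rewrite normc_def; case: x. Qed.

Lemma normc_ge0 (x : C) : 0 <= normc x.
Proof. by case: x => a b; exact: sqrtr_ge0. Qed.

Lemma normcR (x : R) : normc x%:C = `|x|.
Proof. by rewrite /= expr0n /= addr0 sqrtr_sqr. Qed.

Lemma normc_triangle (x y : C) : normc (x + y) <= normc x + normc y.
Proof. exact: (@le_normcD R x y). Qed.

Lemma normc_opp (x : C) : normc (- x) = normc x.
Proof. exact: (@normcN R x). Qed.

Lemma normc_conj (x : C) : normc (Num.conj x) = normc x.
Proof.
apply: (@complexI R); rewrite -!norm_normc; exact: norm_conjC.
Qed.

Lemma normc_Re (x : C) : `|complex.Re x| <= normc x.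
Proof. by rewrite -lecR -norm_normc; exact: normc_ge_Re. Qed.

Lemma normc_Im (x : C) : `|complex.Im x| <= normc x.
Proof.
case: x => a b /=; rewrite -sqrtr_sqr ler_sqrt ?addr_ge0 ?sqr_ge0//.
by rewrite lerDr sqr_ge0.
Qed.

Lemma normc_le_ReIm (x : C) : normc x <= `|complex.Re x| + `|complex.Im x|.
Proof.
case: x => a b /=.
have h : 0 <= `|a| + `|b| by rewrite addr_ge0.
rewrite -(ger0_norm h) -sqrtr_sqr ler_sqrt ?sqr_ge0//.
rewrite sqrrD !real_normK ?num_real// lerD2r lerDl.
by rewrite mulrn_wge0// mulr_ge0.
Qed.

Lemma normcX (x : C) n : normc (x ^+ n) = normc x ^+ n.
Proof.
elim: n => [|n IH]; first by rewrite !expr0; exact: ComplexField.Normc.normc1.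
by rewrite !exprS ComplexField.Normc.normcM IH.
Qed.

(** The real-valued modulus [normc] is used instead of the norm of [R[i]], whose
values are complex: all estimates then take place in the ordered field [R]. *)
Definition mxl1 m n (M : 'M[C]_(m, n)) : R := \sum_i \sum_j normc (M i j).

Lemma mxl1_ge0 m n (M : 'M[C]_(m, n)) : 0 <= mxl1 M.
Proof. by do 2!(apply: sumr_ge0 => ? _); exact: normc_ge0. Qed.

Lemma mxl1_0 m n : mxl1 (0 : 'M[C]_(m, n)) = 0.
Proof. by do 2!(apply: big1 => ? _); rewrite mxE; exact: ComplexField.Normc.normc0. Qed.

Lemma mxl1_entry m n (M : 'M[C]_(m, n)) i j : normc (M i j) <= mxl1 M.
Proof.
rewrite /mxl1 (bigD1 i)//= (bigD1 j)//= -addrA lerDl addr_ge0//.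
  by apply: sumr_ge0 => ? _; exact: normc_ge0.
by do 2!(apply: sumr_ge0 => ? _); exact: normc_ge0.
Qed.

Lemma mxl1_eq0 m n (M : 'M[C]_(m, n)) : mxl1 M <= 0 -> M = 0.
Proof.
move=> M0; apply/matrixP => i j; rewrite mxE.
apply/ComplexField.Normc.eq0_normc/eqP; rewrite eq_le normc_ge0 andbT.
exact: le_trans (mxl1_entry M i j) M0.
Qed.

Lemma mxl1D m n (M N : 'M[C]_(m, n)) : mxl1 (M + N) <= mxl1 M + mxl1 N.
Proof.
rewrite /mxl1 -big_split ler_sum// => i _; rewrite -big_split ler_sum// => j _.
by rewrite mxE; exact: normc_triangle.
Qed.

Lemma mxl1N m n (M : 'M[C]_(m, n)) : mxl1 (- M) = mxl1 M.
Proof. by do 2!(apply: eq_bigr => ? _); rewrite mxE normc_opp. Qed.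

Lemma mxl1Z m n c (M : 'M[C]_(m, n)) : mxl1 (c *: M) = normc c * mxl1 M.
Proof.
rewrite /mxl1 mulr_sumr; apply: eq_bigr => i _; rewrite mulr_sumr.
by apply: eq_bigr => j _; rewrite mxE ComplexField.Normc.normcM.
Qed.

Lemma mxl1_adj m n (M : 'M[C]_(m, n)) : mxl1 (M ^t*) = mxl1 M.
Proof.
rewrite /mxl1 exchange_big; do 2!(apply: eq_bigr => ? _).
by rewrite !mxE normc_conj.
Qed.

Lemma mxl1M m n p (M : 'M[C]_(m, n)) (N : 'M[C]_(n, p)) :
  mxl1 (M *m N) <= mxl1 M * mxl1 N.
Proof.
have normc_sum (I : finType) (F : I -> C) :
    normc (\sum_k F k) <= \sum_k normc (F k).
  elim/big_ind2: _ => // [|x1 x2 y1 y2 h1 h2]; first by rewrite ComplexField.Normc.normc0.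
  exact: le_trans (normc_triangle _ _) (lerD h1 h2).
have row_le k : \sum_j normc (N k j) <= mxl1 N.
  rewrite /mxl1 (bigD1 k)//= lerDl.
  by do 2!(apply: sumr_ge0 => ? _); exact: normc_ge0.
rewrite {1}/mxl1 {2}/mxl1 mulr_suml ler_sum// => i _.
rewrite mulr_suml.
apply: (@le_trans _ _ (\sum_j \sum_k normc (M i k) * normc (N k j))).
  apply: ler_sum => j _; rewrite mxE (le_trans (normc_sum _ _))// ler_sum// => k _.
  by rewrite ComplexField.Normc.normcM.
rewrite exchange_big ler_sum// => k _.
by rewrite -mulr_sumr ler_wpM2l ?normc_ge0.
Qed.

(** Stated through a real sequence, so that limits of matrices are obtained by
real squeezing; [mxcvg_lim] ties it to the topology of ['M_2]. *)
Definition mxcvg m n (u : nat -> 'M[C]_(m, n)) (L : 'M[C]_(m, n)) :=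
  (fun k => mxl1 (u k - L)) @ \oo --> (0 : R).

Lemma mxcvg_lim (u : nat -> 'M[C]_2) L : mxcvg u L -> limn u = L.
Proof.
move=> uL; apply: cvg_lim; first exact: norm_hausdorff.
apply/cvg_ballP => e e0.
have eE : (complex.Re e)%:C = e by rewrite RRe_real// gtr0_real.
have Re0 : 0 < complex.Re e by rewrite -ltcR eE.
move/cvgr0Pnorm_lt: uL => /(_ _ Re0); apply: filterS => k.
rewrite ger0_norm ?mxl1_ge0// => hk; split=> // i j.
rewrite -ball_normE /ball_ /= distrC norm_normc -eE ltcR.
by apply: le_lt_trans hk; have := mxl1_entry (u k - L) i j; rewrite !mxE.
Qed.

Lemma mxcvg_squeeze m n (u : nat -> 'M[C]_(m, n)) L (B : nat -> R) :
  (forall k, mxl1 (u k - L) <= B k) -> B @ \oo --> (0 : R) -> mxcvg u L.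
Proof.
by move=> uB; apply: squeeze0 => k; rewrite mxl1_ge0 uB.
Qed.

Lemma mxcvg_unique m n (u : nat -> 'M[C]_(m, n)) L L' :
  mxcvg u L -> mxcvg u L' -> L = L'.
Proof.
move=> uL uL'; apply/eqP; rewrite -subr_eq0; apply/eqP/mxl1_eq0.
have cst0 : (fun _ : nat => mxl1 (L - L')) @ \oo --> (0 : R).
  apply: squeeze0 (cvg0D uL uL') => k.
  rewrite mxl1_ge0/= -[mxl1 (u k - L)]mxl1N (le_trans _ (mxl1D _ _))//.
  by rewrite opprB subrKA.
by rewrite (cvg_unique _ cst0 (cvg_cst _)).
Qed.

Lemma mxcvg_cst m n (L : 'M[C]_(m, n)) : mxcvg (fun=> L) L.
Proof.
by apply: (@mxcvg_squeeze _ _ _ _ (fun=> 0)) => [k|]; [rewrite subrr mxl1_0|exact: cvg_cst].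
Qed.

Lemma mxcvg_shift m n (u : nat -> 'M[C]_(m, n)) N L :
  mxcvg u L -> mxcvg (fun k => u (N + k)%N) L.
Proof.
rewrite /mxcvg => uL; rewrite -(cvg_shiftn N) in uL.
by under eq_fun do rewrite addnC.
Qed.

Lemma mxcvgD m n (u u' : nat -> 'M[C]_(m, n)) L L' :
  mxcvg u L -> mxcvg u' L' -> mxcvg (fun k => u k + u' k) (L + L').
Proof.
move=> uL uL'; apply: mxcvg_squeeze (cvg0D uL uL') => k.
by rewrite opprD addrACA mxl1D.
Qed.

Lemma mxcvgN m n (u : nat -> 'M[C]_(m, n)) L :
  mxcvg u L -> mxcvg (fun k => - u k) (- L).
Proof.
by move=> uL; apply: mxcvg_squeeze uL => k; rewrite -opprD mxl1N.
Qed.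

Lemma mxcvgMl m n p (M : 'M[C]_(m, n)) (u : nat -> 'M[C]_(n, p)) L :
  mxcvg u L -> mxcvg (fun k => M *m u k) (M *m L).
Proof.
move=> uL; apply: mxcvg_squeeze (cvg0Ml (mxl1 M) uL) => k.
by rewrite -mulmxBr; exact: mxl1M.
Qed.

Lemma mxcvg_adj m n (u : nat -> 'M[C]_(m, n)) L :
  mxcvg u L -> mxcvg (fun k => (u k) ^t*) (L ^t*).
Proof.
move=> uL; apply: mxcvg_squeeze uL => k.
by rewrite -[leRHS]mxl1_adj linearB/= map_mxB.
Qed.

(** Absolute convergence implies convergence: the real and imaginary parts of
the entries are absolutely convergent real series. *)
Lemma mxcvg_series m n (u : nat -> 'M[C]_(m, n)) (B : nat -> R) :
  (forall k, mxl1 (u k) <= B k) -> cvgn (series B) ->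
  exists L, mxcvg (series u) L.
Proof.
move=> uB cB.
have part (f : C -> R) i j : (forall x, `|f x| <= normc x) ->
    cvgn (series (fun k => f (u k i j))).
  move=> fb; apply: normed_cvg; apply: series_le_cvg cB => k /=; first by [].
    by rewrite (le_trans _ (uB k))// mxl1_ge0.
  by rewrite (le_trans (fb _))// (le_trans (mxl1_entry _ _ _)).
pose re i j := limn (series (fun k => complex.Re (u k i j))).
pose im i j := limn (series (fun k => complex.Im (u k i j))).
exists (\matrix_(i, j) (re i j +i* im i j)).
have toL (f : C -> R) i j : (forall x y, f (x + y) = f x + f y) ->
    (forall x, `|f x| <= normc x) ->
    (fun N => `|f (series u N i j) - limn (series (fun k => f (u k i j)))|)
      @ \oo --> (0 : R).
  move=> fD fb; apply/norm_cvg0P.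
  have fS N : f (series u N i j) = series (fun k => f (u k i j)) N.
    elim: N => [|N IH].
      rewrite /series/= !big_geq// mxE; apply: (addIr (f 0)).
      by rewrite -fD !add0r.
    by rewrite !seriesSr mxE fD IH.
  under eq_fun do rewrite fS.
  set l := limn _; rewrite -(subrr l).
  by apply: cvgB; [exact: part|exact: cvg_cst].
apply: (@squeeze0 _ _ (fun N => \sum_i \sum_j
    (`|complex.Re (series u N i j) - re i j| +
     `|complex.Im (series u N i j) - im i j|))); last first.
  apply: cvg0_sum => i; apply: cvg0_sum => j; apply: cvg0D.
    apply: toL => [[? ?] [? ?]//|]; exact: normc_Re.
  apply: toL => [[? ?] [? ?]//|]; exact: normc_Im.
move=> N; rewrite mxl1_ge0 /=.
apply: ler_sum => i _; apply: ler_sum => j _; rewrite !mxE.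
apply: le_trans (normc_le_ReIm _) _.
by case: (series u N i j) => x y.
Qed.
End MatrixConvergence.

(** * Explicit two-by-two matrices *)

Section TwoByTwo.
Variable F : comNzRingType.
Implicit Types x y z t c : F.

Lemma matrix2P (M N : 'M[F]_2) : M 0 0 = N 0 0 -> M 0 1 = N 0 1 ->
  M 1 0 = N 1 0 -> M 1 1 = N 1 1 -> M = N.
Proof.
move=> h00 h01 h10 h11; apply/matrixP => i j.
have /orP[/eqP->|/eqP->] : (i == 0) || (i == 1) by case: i => [[|[]]].
  by have /orP[/eqP->|/eqP->] : (j == 0) || (j == 1) by case: j => [[|[]]].
by have /orP[/eqP->|/eqP->] : (j == 0) || (j == 1) by case: j => [[|[]]].
Qed.

Lemma mx2D x y z t x' y' z' t' :
  mx2 x y z t + mx2 x' y' z' t' = mx2 (x + x') (y + y') (z + z') (t + t').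
Proof. by apply: matrix2P; rewrite !mxE. Qed.

Lemma mx2N x y z t : - mx2 x y z t = mx2 (- x) (- y) (- z) (- t).
Proof. by apply: matrix2P; rewrite !mxE. Qed.

Lemma mx2Z c x y z t : c *: mx2 x y z t = mx2 (c * x) (c * y) (c * z) (c * t).
Proof. by apply: matrix2P; rewrite !mxE. Qed.

Lemma mx2M x y z t x' y' z' t' :
  mx2 x y z t *m mx2 x' y' z' t' =
  mx2 (x * x' + y * z') (x * y' + y * t') (z * x' + t * z') (z * y' + t * t').
Proof. by apply: matrix2P; rewrite !mxE !big_ord_recl big_ord0 !mxE addr0. Qed.

Lemma mx2_scalar c : c%:M = mx2 c 0 0 c.
Proof. by apply: matrix2P; rewrite !mxE. Qed.

Definition mx2E := (mx2_scalar, mx2D, mx2N, mx2Z, mx2M).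
End TwoByTwo.

Lemma mx2_upper_unit (F : fieldType) (x y t : F) :
  x != 0 -> t != 0 -> mx2 x y 0 t \in unitmx.
Proof.
move=> x0 t0; suff /mulmx1_unit[] : mx2 x y 0 t *m mx2 x^-1 (- y / (x * t)) 0 t^-1 = 1%:M by [].
by rewrite !mx2E; congr mx2; field; rewrite ?x0 ?t0.
Qed.

Section Adjoint.
Variable R : realType.
Local Notation C := R[i].

Lemma adjM m n p (M : 'M[C]_(m, n)) (N : 'M[C]_(n, p)) :
  (M *m N) ^t* = N ^t* *m M ^t*.
Proof. by rewrite trmx_mul map_mxM. Qed.

Lemma adjK m n (M : 'M[C]_(m, n)) : M ^t* ^t* = M.
Proof. by apply/matrixP => i j; rewrite !mxE conjCK. Qed.

Lemma adjD m n (M N : 'M[C]_(m, n)) : (M + N) ^t* = M ^t* + N ^t*.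
Proof. by rewrite linearD/= map_mxD. Qed.

Lemma adjN m n (M : 'M[C]_(m, n)) : (- M) ^t* = - M ^t*.
Proof. by rewrite linearN/= map_mxN. Qed.

Lemma adj_realZ m n (c : R) (M : 'M[C]_(m, n)) : (c%:C *: M) ^t* = c%:C *: M ^t*.
Proof.
apply/matrixP => i j; rewrite !mxE rmorphM/=; congr (_ * _).
exact: conjc_real.
Qed.

Lemma adjX (M : 'M[C]_2) n : (M ^+ n) ^t* = (M ^t*) ^+ n.
Proof.
elim: n => [|n IH]; first by rewrite !expr0 -[1]/(1%:M) trmx1 map_mx1.
by rewrite exprS -[M * _]/(M *m _) adjM IH exprSr.
Qed.

(** The identity behind the symmetry: for an operator acting on sequences as
g |-> t g_(x-1) + g_x D + e g_(x+1) with real t, e and self-adjoint D, the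
middle terms cancel and only the two neighbouring cross terms survive. *)
Lemma discrete_green (p0 p1 p2 s0 s1 s2 D : 'M[C]_2) (c t e : R) : D ^t* = D ->
  c%:C *: ((t%:C *: p0 + p1 *m D + e%:C *: p2) *m s1 ^t*)
  - c%:C *: (p1 *m (t%:C *: s0 + s1 *m D + e%:C *: s2) ^t*) =
  (c * e)%:C *: (p2 *m s1 ^t* - p1 *m s2 ^t*)
  - (c * t)%:C *: (p1 *m s0 ^t* - p0 *m s1 ^t*).
Proof.
move=> DD; rewrite !adjD !adj_realZ adjM DD.
rewrite !mulmxDl !mulmxDr -!scalemxAl -!scalemxAr -mulmxA.
have cM (d : R) : (c * d)%:C = c%:C * d%:C :> C by exact: rmorphM.
rewrite !{}cM; move: (c%:C) (t%:C) (e%:C) => {c t e} c t e.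
move: (s0 ^t* ) (s1 ^t* ) (s2 ^t* ) => r0 r1 r2.
move: (p1 *m (D *m r1)) (p0 *m r1) (p2 *m r1) (p1 *m r0) (p1 *m r2) => Y0 Y1 Y2 Y3 Y4.
by apply/matrixP => i j; rewrite !mxE; ring.
Qed.

End Adjoint.

(** * Evaluation of matrix polynomials *)

Section Peval.
Variable R : realType.
Local Notation C := R[i].
Implicit Types (P S : {poly 'M[C]_2}) (z : C).

Lemma peval_wide n P z : (size P <= n)%N ->
  peval P z = \sum_(k < n) z ^+ k *: P`_k.
Proof.
move=> Pn; rewrite /peval (horner_coef_wide _ Pn); apply: eq_bigr => k _.
by rewrite -rmorphXn/= -[_ * _]/(_ *m _) mul_mx_scalar.
Qed.

Lemma pevalD P S z : peval (P + S) z = peval P z + peval S z.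
Proof. exact: hornerD. Qed.

Lemma pevalCM M P z : peval (M%:P * P) z = M *m peval P z.
Proof. exact: hornerCM. Qed.

Lemma peval_eq0 P (x : nat -> C) : injective x ->
  (forall n, peval P (x n) = 0) -> P = 0.
Proof.
move=> xinj Px; apply/polyP => k; rewrite coef0; apply/matrixP => i j; rewrite mxE.
pose pij : {poly C} := \poly_(l < size P) P`_l i j.
have pij_root n : root pij (x n).
  have /matrixP/(_ i j) := Px n; rewrite (peval_wide _ (leqnn _)) summxE mxE => Pij.
  rewrite /root horner_poly; apply/eqP; rewrite -[RHS]Pij.
  by apply: eq_bigr => l _; rewrite mxE mulrC.
have pij0 : pij = 0.
  apply: (@roots_geq_poly_eq0 _ _ (map x (iota 0 (size pij)))).
  - by apply/allP => _ /mapP[n _ ->].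
  - by rewrite map_inj_uniq// iota_uniq.
  - by rewrite size_map size_iota.
have [kP|Pk] := ltnP k (size P); last by rewrite nth_default// mxE.
by have /polyP/(_ k) := pij0; rewrite coef_poly kP coef0.
Qed.

End Peval.

(** * Algebra of the difference equation *)

(** Here zk and qk stand for the powers z^k and q^k and Ai for the inverse of A:
the contribution of one monomial p z^k to both sides of [peval_qdiff]. *)
Lemma qdiff_coef (F : fieldType) (p K A Ai : 'M[F]_2) (z zk qk q a b : F) :
  qk != 0 ->
  (z * zk) *: (p *m (K - qk^-1 *: Ai - (a * b * (q * qk)) *: A))
  + zk *: (p *m ((qk^-1 - 1) *: (Ai - (a * qk) *: A))) =
  (1 - z) *: ((qk^-1 * zk) *: (p *m Ai))
  + zk *: (p *m (z *: K - Ai - a *: A))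
  + (a - a * b * q * z) *: ((qk * zk) *: (p *m A)).
Proof.
move=> qk0; rewrite !mulmxBr -!scalemxAr !mulmxBr -!scalemxAr.
by apply/matrixP => i j; rewrite !mxE; field.
Qed.

(** Right multiplication by X removes the inverse Xi from the eigenvalue
equation of the difference operator. *)
Lemma clear_inverse (F : fieldType) (pm p0 pp d : 'rV[F]_2) (X Y Xi : 'M[F]_2)
    (z l e c : F) : Xi *m X = 1%:M -> d = l *: p0 ->
  z *: d = (1 - z) *: (pm *m Xi) + p0 *m (z *: Y - Xi - e *: X) + c *: (pp *m X) ->
  (1 - z) *: pm + p0 *m (z *: ((Y - l%:M) *m X) - (1%:M + e *: (X *m X)))
  + pp *m (c *: (X *m X)) = 0.
Proof.
move=> XiX -> /(congr1 (mulmx^~ X)) /=.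
rewrite !mulmxDl -!scalemxAl -!mulmxA XiX mulmx1 !mulmxDl -!scalemxAl !mulNmx.
rewrite XiX -!scalemxAl mul_scalar_mx => E.
rewrite -[RHS](subrr (z *: (l *: (p0 *m X)))) {1}E.
rewrite !mulmxDr !mulmxN !mulmxDr -!scalemxAr !mulmxDr !mulmxN -!scalemxAr mulmx1.
move: (p0 *m (Y *m X)) (p0 *m X) (p0 *m (X *m X)) (pp *m (X *m X)) => Y1 Y2 Y3 Y4.
by apply/rowP => j; rewrite !mxE; ring.
Qed.

(** The coefficient of z^k in the eigenvalue equation, multiplied by X on the
right, factors: one side is (q^(-k-1) - 1) p' U, the other q^(-k) p G, where
G and U are the factors that define the Pochhammer symbol of the series. *)
Lemma coef_recurrence (F : fieldType) (p p' : 'rV[F]_2) (X Y Xi : 'M[F]_2)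
    (l e f qk q : F) (U := 1%:M - (q * qk) *: (e *: (X *m X)))
    (G := 1%:M - qk *: (Y *m X - l *: X)
                  - qk ^+ 2 *: (- (e * f * q) *: (X *m X))) :
  q != 0 -> qk != 0 -> 1 - q * qk != 0 -> Xi *m X = 1%:M -> U \in unitmx ->
  p *m (Y - qk^-1 *: Xi - (e * f * (q * qk)) *: X)
    + p' *m (((q * qk)^-1 - 1) *: (Xi - (e * (q * qk)) *: X)) = l *: p ->
  p' = (q / (1 - q * qk)) *: (p *m G *m invmx U).
Proof.
move=> q0 qk0 qk1 XiX Uu /(congr1 (mulmx^~ X)) /= E.
rewrite mulmxDl -!mulmxA -!scalemxAl !mulmxBl -!scalemxAl XiX in E.
have {}E : p' *m U = (q / (1 - q * qk)) *: (p *m G).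
  rewrite /U /G.
  rewrite !mulmxBr -!scalemxAr !mulmxBr -!scalemxAr !mulmx1 in E *.
  move: (p *m (Y *m X)) (p *m X) (p *m (X *m X)) (p' *m (X *m X)) E => Y1 Y2 Y3 Y4 E.
  apply/rowP => j; move/rowP/(_ j): E; rewrite !mxE => E.
  have c0 : (q * qk)^-1 - 1 != 0.
    have -> : (q * qk)^-1 - 1 = (1 - q * qk) * (q * qk)^-1.
      by rewrite mulrBl mul1r mulfV// mulf_neq0.
    by rewrite mulf_neq0// invr_eq0 mulf_neq0.
  apply: (mulfI c0); apply: (addrI (Y1 0 j - qk^-1 * p 0 j - e * f * (q * qk) * Y3 0 j)).
  transitivity (l * Y2 0 j); last by field; rewrite qk0 q0 qk1.
  by rewrite -E; ring.
by rewrite scalemxAl -E mulmxK.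
Qed.

(** * Convergence of the matrix q-hypergeometric series *)

Section EtaConvergence.
Variables (R : realType) (q : R) (X Y Z : 'M[R[i]]_2).
Hypothesis q01 : 0 < q < 1.
Hypothesis unitZ : forall k, 1%:M - q%:C ^+ k.+1 *: Z \in unitmx.
Local Notation C := R[i].
Local Notation normc := (@ComplexField.Normc.normc R).

Definition eta_term (z : C) k : 'M[C]_2 :=
  (z ^+ k / qpoch q%:C q%:C k) *: eta_poch X Y Z q%:C k.

Lemma qpochS (F : pzRingType) (c p : F) k :
  qpoch c p k.+1 = qpoch c p k * (1 - c * p ^+ k).
Proof. by rewrite /qpoch big_ord_recr. Qed.

Lemma eta_termS z k : eta_term z k.+1 = (z / (1 - q%:C ^+ k.+1)) *:
  (eta_term z k *m (1%:M - q%:C ^+ k *: X - q%:C ^+ (2 * k) *: Y)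
   *m invmx (1%:M - q%:C ^+ k.+1 *: Z)).
Proof.
rewrite /eta_term qpochS -exprS -[eta_poch _ _ _ _ k.+1]/(_ *m _ *m invmx _).
rewrite -!scalemxAl scalerA; congr (_ *: _).
by rewrite exprS invfM; ring.
Qed.

(** Instead of estimating the inverse of I - q^(k+1) Z, one multiplies the
recurrence by this matrix and absorbs the term q^(k+1) S Z on the left. *)
Lemma mxl1_eta_termS z k (c := mxl1 X + mxl1 Y + mxl1 Z) :
  (1 - q ^+ k) * ((1 - c * q ^+ k) * mxl1 (eta_term z k.+1)) <=
  normc z * ((1 + c * q ^+ k) * mxl1 (eta_term z k)).
Proof.
case/andP: q01 => q0 q1.
have X0 := mxl1_ge0 X; have Y0 := mxl1_ge0 Y; have Z0 := mxl1_ge0 Z.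
have c0 : 0 <= c by rewrite !addr_ge0.
have nq m : normc (q%:C ^+ m : C) = q ^+ m.
  by rewrite normcX normcR gtr0_norm.
have qS : q ^+ k.+1 <= q ^+ k by rewrite ler_wiXn2l// ltW.
have qk0 : 0 <= q ^+ k by rewrite exprn_ge0// ltW.
have qk1 : q ^+ k <= 1 by rewrite exprn_ile1// ltW.
have q2k : q ^+ (2 * k) <= q ^+ k.
  by rewrite mul2n -addnn exprD ler_piMl.
set S := eta_term z k.+1; set T := eta_term z k.
set G := 1%:M - q%:C ^+ k *: X - q%:C ^+ (2 * k) *: Y.
have T0 := mxl1_ge0 T; have S0 := mxl1_ge0 S.
have TG : mxl1 (T *m G) <= (1 + c * q ^+ k) * mxl1 T.
  have -> : T *m G = T - q%:C ^+ k *: (T *m X) - q%:C ^+ (2 * k) *: (T *m Y).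
    by rewrite /G !mulmxBr mulmx1 -!scalemxAr.
  apply: le_trans (mxl1D _ _) _; rewrite mxl1N mxl1Z nq.
  apply: le_trans (lerD (mxl1D _ _) (lexx _)) _; rewrite mxl1N mxl1Z nq.
  have hX : q ^+ k * mxl1 (T *m X) <= q ^+ k * (mxl1 T * mxl1 X).
    by rewrite ler_wpM2l// mxl1M.
  have hY : q ^+ (2 * k) * mxl1 (T *m Y) <= q ^+ k * (mxl1 T * mxl1 Y).
    by rewrite ler_pM ?mxl1M ?mxl1_ge0// exprn_ge0// ltW.
  have hZ : 0 <= q ^+ k * (mxl1 T * mxl1 Z) by rewrite !mulr_ge0.
  rewrite -subr_ge0; rewrite -subr_ge0 in hX; rewrite -subr_ge0 in hY.
  by have := addr_ge0 (addr_ge0 hX hY) hZ; congr (0 <= _); rewrite /c; ring.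
have SU : S *m (1%:M - q%:C ^+ k.+1 *: Z) = (z / (1 - q%:C ^+ k.+1)) *: (T *m G).
  by rewrite /S eta_termS -scalemxAl mulmxKV.
have hS : (1 - c * q ^+ k) * mxl1 S <= mxl1 (S *m (1%:M - q%:C ^+ k.+1 *: Z)).
  have -> : S *m (1%:M - q%:C ^+ k.+1 *: Z) = S - q%:C ^+ k.+1 *: (S *m Z).
    by rewrite mulmxBr mulmx1 -scalemxAr.
  have := mxl1D (S - q%:C ^+ k.+1 *: (S *m Z)) (q%:C ^+ k.+1 *: (S *m Z)).
  rewrite subrK mxl1Z nq -lerBlDr; apply: le_trans.
  rewrite mulrBl mul1r lerB//.
  apply: le_trans (_ : q ^+ k * (mxl1 S * mxl1 Z) <= _).
    by rewrite ler_pM ?mxl1M ?mxl1_ge0// exprn_ge0// ltW.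
  rewrite [c * _]mulrC -mulrA ler_wpM2l// mulrC ler_wpM2r//.
  by rewrite /c lerDr addr_ge0.
rewrite SU mxl1Z in hS.
have nk : (1 - q ^+ k) * normc (z / (1 - q%:C ^+ k.+1)) <= normc z.
  have d0 : 0 < 1 - q ^+ k.+1 by rewrite subr_gt0 exprn_ilt1// ltW.
  rewrite ComplexField.Normc.normcM ComplexField.Normc.normcV.
  have -> : 1 - q%:C ^+ k.+1 = (1 - q ^+ k.+1)%:C :> C.
    by rewrite rmorphB rmorph1 rmorphXn.
  rewrite normcR gtr0_norm// mulrCA ler_piMr ?normc_ge0//.
  by rewrite ler_pdivrMr// mul1r lerB.
apply: le_trans (ler_wpM2l _ hS) _; first by rewrite subr_ge0.
rewrite mulrA ler_pM ?mxl1_ge0// mulr_ge0 ?normc_ge0//.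
by rewrite subr_ge0.
Qed.

(** The ratios of consecutive norms are asymptotically at most |z|, so that the
ratio test applies with any r between |z| and 1. *)
Lemma eta_cvg z : normc z < 1 -> exists L, mxcvg (series (eta_term z)) L.
Proof.
move=> z1; case/andP: q01 => q0 q1.
have z0 := normc_ge0 z.
apply: (@mxcvg_series _ _ _ _ (fun k => mxl1 (eta_term z k))) => //.
pose c := mxl1 X + mxl1 Y + mxl1 Z.
have c0 : 0 <= c by rewrite !addr_ge0 ?mxl1_ge0.
pose r := (1 + normc z) / 2.
have q01' : 0 <= q < 1 by rewrite ltW.
(* Once c q^k and q^k are this small, the bound of [mxl1_eta_termS] gives the
   ratio r. *)
have e0 : 0 < (1 - normc z) / (2 * (1 + 2 * c)).
  by rewrite divr_gt0 ?subr_gt0// mulr_gt0// ltr_wpDr// mulr_ge0.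
have [N hN] := exprn_eventually_lt q01' e0.
apply: (@ratio_test _ _ r N) => [k||k Nk]; first exact: mxl1_ge0.
  by apply/andP; split; rewrite /r; lra.
have := hN k Nk; rewrite ltr_pdivlMr; last by rewrite mulr_gt0// ltr_wpDr// mulr_ge0.
have := mxl1_eta_termS z k; rewrite -/c.
have qk0 : 0 <= q ^+ k by rewrite exprn_ge0// ltW.
have := mxl1_ge0 (eta_term z k); have := mxl1_ge0 (eta_term z k.+1).
clear hN e0; rewrite /r; move: z0 z1 qk0 c0.
move: (normc z) (q ^+ k) c (mxl1 _) (mxl1 _) => p e d s t p0 p1 e0' d0 s0 t0 hst he.
have f0 : 0 <= d * e by rewrite mulr_ge0.
rewrite [d * e]mulrC in hst f0 *; have {}he : 2 * e + 4 * (e * d) < 1 - p by lra.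
move: (e * d) f0 hst he => f f0 hst he.
have d1 : 0 < (1 - e) * (1 - f) by rewrite mulr_gt0//; lra.
have key : p * (1 + f) <= (1 + p) / 2 * ((1 - e) * (1 - f)).
  have ef : 1 - e - f <= (1 - e) * (1 - f) by have := mulr_ge0 e0' f0; lra.
  have p2 : 0 <= (1 + p) / 2 by lra.
  apply: le_trans _ (ler_wpM2l p2 ef).
  have pe : p * e <= e by rewrite ler_piMl// ltW.
  have pf : p * f <= f by rewrite ler_piMl// ltW.
  by lra.
rewrite -(ler_pM2l d1) -[leLHS]mulrA (le_trans hst)//.
have := ler_wpM2r t0 key; lra.
Qed.
End EtaConvergence.

(** * The difference operator on polynomials *)

Section DifferenceOperator.
Variables (R : realType) (q a b : R) (v : R[i]).
Hypotheses (hq : 0 < q < 1) (ha : 0 < a < q^-1) (hb : b < q^-1).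
Local Notation C := R[i].
Local Notation A := (Amx q v).
Local Notation K := (Kmx q a v).
Implicit Types (P S : {poly 'M[C]_2}) (z : C).

Let q0 : 0 < q. Proof. by case/andP: hq. Qed.
Let qC0 : q%:C != 0 :> C.
Proof. by rewrite (inj_eq (@complexI R)) gt_eqF. Qed.

Definition Ainv : 'M[C]_2 := mx2 q%:C^-1 (v * (1 - q%:C) / q%:C) 0 1.

Lemma mulA_Ainv : A *m Ainv = 1%:M.
Proof. by rewrite /Amx /Ainv !mx2E; congr mx2; field. Qed.

Lemma mulAinv_A : Ainv *m A = 1%:M.
Proof. by rewrite /Amx /Ainv !mx2E; congr mx2; field. Qed.

Lemma exprAmx n : A ^+ n = mx2 (q%:C ^+ n) (- v * (1 - q%:C ^+ n)) 0 1.
Proof.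
elim: n => [|n IH].
  by rewrite expr0 -[1]/(1%:M) mx2E; congr mx2; ring.
by rewrite exprSr IH -[_ * _]/(_ *m _) /Amx !mx2E; congr mx2; rewrite ?exprS; ring.
Qed.

(** The difference operator sends the monomial z^k to
z^k Bcoef k + z^(k-1) Ccoef k. *)
Definition Bcoef n : 'M[C]_2 :=
  K - q%:C ^- n *: Ainv - (a%:C * b%:C * q%:C ^+ n.+1) *: A.
Definition Ccoef n : 'M[C]_2 :=
  (q%:C ^- n - 1) *: (Ainv - (a%:C * q%:C ^+ n) *: A).

(** Right action of the difference operator with coefficients
(1/z - 1) A^-1, K - (A^-1 + a A)/z, (a/z - a b q) A at the points z/q, z, q z.
It is given by its coefficients because division by z is only meaningful on
polynomials; [peval_qdiff] is the pointwise formula. *)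
Definition qdiff P : {poly 'M[C]_2} :=
  \poly_(k < size P) (P`_k *m Bcoef k + P`_k.+1 *m Ccoef k.+1).

Lemma coef_qdiff P k : (qdiff P)`_k = P`_k *m Bcoef k + P`_k.+1 *m Ccoef k.+1.
Proof.
rewrite coef_poly; case: ltnP => // Pk.
by rewrite !nth_default// ?mul0mx ?addr0// (leq_trans Pk).
Qed.

Lemma peval_qdiff P z :
  z *: peval (qdiff P) z =
  (1 - z) *: (peval P (q%:C^-1 * z) *m Ainv)
  + peval P z *m (z *: K - Ainv - a%:C *: A)
  + (a%:C - a%:C * b%:C * q%:C * z) *: (peval P (q%:C * z) *m A).
Proof.
have Pn := leqnn (size P); set n := size P in Pn *.
rewrite (peval_wide _ (size_poly _ _)) !(peval_wide _ Pn) -/n.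
have C0 : Ccoef 0 = 0 by rewrite /Ccoef expr0 invr1 subrr scale0r.
have shift : \sum_(k < n) z ^+ k.+1 *: (P`_k.+1 *m Ccoef k.+1) =
    \sum_(k < n) z ^+ k *: (P`_k *m Ccoef k).
  transitivity (\sum_(k < n.+1) z ^+ k *: (P`_k *m Ccoef k)).
    by rewrite big_ord_recl C0 mulmx0 scaler0 add0r.
  by rewrite big_ord_recr/= [P`_n]nth_default// mul0mx scaler0 addr0.
transitivity (\sum_(k < n) (z ^+ k.+1 *: (P`_k *m Bcoef k)
                             + z ^+ k *: (P`_k *m Ccoef k))).
  rewrite big_split/= -shift -big_split scaler_sumr; apply: eq_bigr => k _ /=.
  by rewrite coef_qdiff scalerA -exprS scalerDr.
rewrite !mulmx_suml !scaler_sumr -!big_split; apply: eq_bigr => k _ /=.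
rewrite -!scalemxAl !exprMn exprVn /Bcoef /Ccoef !exprS.
exact/qdiff_coef/expf_neq0.
Qed.

(** * The scalar weight *)

Definition cwt x : R := a ^+ x * (qpoch (b * q) q x / qpoch q q x).

Let q1 : q < 1. Proof. by case/andP: hq. Qed.
Let a0 : 0 < a. Proof. by case/andP: ha. Qed.
Let aq1 : a * q < 1. Proof. by rewrite -ltr_pdivlMr// div1r; case/andP: ha. Qed.
Let bq1 : b * q < 1. Proof. by rewrite -ltr_pdivlMr// div1r. Qed.

Lemma qX_le1 n : q ^+ n <= 1. Proof. by rewrite exprn_ile1// ltW. Qed.
Lemma qX_lt1 n : q ^+ n.+1 < 1. Proof. by rewrite exprn_ilt1// ltW. Qed.

Lemma one_sub_bq_gt0 n : 0 < 1 - b * q ^+ n.+1.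
Proof.
rewrite subr_gt0 exprS mulrA; have [b0|b0] := leP 0 (b * q).
  by rewrite (le_lt_trans _ bq1)// ler_piMr// qX_le1.
by rewrite (lt_trans _ ltr01)// pmulr_llt0// exprn_gt0.
Qed.

Lemma one_sub_aq_gt0 n : 0 < 1 - a * q ^+ n.+1.
Proof.
rewrite subr_gt0 exprS mulrA (le_lt_trans _ aq1)// ler_piMr ?qX_le1//.
by rewrite mulr_ge0// ltW.
Qed.

Lemma one_sub_abq_gt0 n : 0 < 1 - a * b * q ^+ n.+2.
Proof.
have -> : a * b * q ^+ n.+2 = (a * q) * (b * q ^+ n.+1) by rewrite exprS; ring.
have := one_sub_bq_gt0 n; rewrite subr_gt0 subr_gt0 => bq.
have aq : 0 < a * q by rewrite mulr_gt0.
have [b0|b0] := leP (b * q ^+ n.+1) 0.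
  by rewrite (le_lt_trans _ ltr01)// pmulr_rle0.
by rewrite (lt_trans _ aq1)// gtr_pMr.
Qed.

Lemma cwt_gt0 x : 0 < cwt x.
Proof.
rewrite mulr_gt0 ?exprn_gt0// divr_gt0// prodr_gt0// => i _.
  by rewrite -mulrA -exprS one_sub_bq_gt0.
by rewrite -exprS subr_gt0 qX_lt1.
Qed.

(** The Pearson equation of the weight. *)
Lemma cwtS x : cwt x.+1 * (1 - q ^+ x.+1) = cwt x * (a * (1 - b * q ^+ x.+1)).
Proof.
rewrite /cwt /qpoch !big_ord_recr/= -[b * q * _]mulrA -exprS.
have : 1 - q ^+ x.+1 != 0 by rewrite gt_eqF// subr_gt0 qX_lt1.
have : \prod_(i < x) (1 - q * q ^+ i) != 0.
  by apply/prodf_neq0 => i _; rewrite gt_eqF// -exprS subr_gt0 qX_lt1.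
move: (\prod_(i < x) (1 - q * q ^+ i)) (\prod_(i < x) _) => D N D0 x0.
rewrite [a ^+ _]exprSr.
move: (q ^+ x.+1) x0 => t t0; field.
by rewrite D0.
Qed.

Definition wt x : R := q ^+ x * cwt x.

Lemma wt_ge0 x : 0 <= wt x.
Proof. by rewrite mulr_ge0 ?exprn_ge0 ?ltW ?cwt_gt0. Qed.

(** The ratio of consecutive terms tends to a q < 1. *)
Lemma cvg_series_wt : cvgn (series wt).
Proof.
pose r := (1 + a * q) / 2.
have r1 : 0 < r < 1 by apply/andP; split; rewrite /r; have := mulr_gt0 a0 q0; have := aq1; lra.
(* The ratio bound r holds at x as soon as 0 <= s x.+1. *)
pose s x := r * (1 - q ^+ x) - a * q * (1 - b * q ^+ x).
have [N hN] : exists N, forall x, (N <= x)%N -> 0 <= s x.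
  pose d := `|r - a * q * b| + 1.
  have d0 : 0 < d by rewrite ltr_wpDl.
  have q01 : 0 <= q < 1 by rewrite ltW.
  have e0 : 0 < (r - a * q) / d.
    by rewrite divr_gt0// /r; have := aq1; lra.
  have [N hN] := exprn_eventually_lt q01 e0.
  exists N => x /hN; rewrite ltr_pdivlMr// => h.
  have -> : s x = (r - a * q) - q ^+ x * (r - a * q * b) by rewrite /s; ring.
  rewrite subr_ge0 (le_trans _ (ltW h))// ler_wpM2l ?exprn_ge0 ?(ltW q0)//.
  by rewrite (le_trans (ler_norm _))// lerDl.
apply: (@ratio_test _ _ r N) => //; first exact: wt_ge0.
move=> n Nn; have qn : 0 < 1 - q ^+ n.+1 by rewrite subr_gt0 qX_lt1.
rewrite -(ler_pM2r qn) -subr_ge0 /wt -[in X in _ - X]mulrA cwtS.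
have -> : r * (q ^+ n * cwt n) * (1 - q ^+ n.+1) -
    q ^+ n.+1 * (cwt n * (a * (1 - b * q ^+ n.+1))) = wt n * s n.+1.
  by rewrite /s /wt exprS; ring.
by rewrite mulr_ge0 ?wt_ge0 ?hN// leqW.
Qed.

Lemma wt_cvg0 : wt @ \oo --> (0 : R).
Proof. exact: cvg_series_cvg_0 cvg_series_wt. Qed.

(** * Polynomials on the lattice, gauged by powers of A *)

(** Absorbing A^x into the value at q^x turns the matrix weight into a scalar
one. *)
Definition lat P x : 'M[C]_2 := peval P (q%:C ^+ x) *m A ^+ x.

(** Since A^x is affine in q^x, these values are polynomial in q^x: they stay
bounded, and their increments are O(q^x). *)
Lemma lat_bounds P : exists B : R, [/\ 0 <= B, forall x, mxl1 (lat P x) <= B &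
  forall x, mxl1 (lat P x.+1 - lat P x) <= B * q ^+ x].
Proof.
pose Ainf : 'M[C]_2 := mx2 0 (- v) 0 1; pose A0 : 'M[C]_2 := mx2 1 v 0 0.
have AE x : A ^+ x = Ainf + q%:C ^+ x *: A0.
  by rewrite exprAmx /Ainf /A0 !mx2E; congr mx2; ring.
have latE x : lat P x = \sum_(k < size P)
    (q%:C ^+ (x * k) *: (P`_k *m Ainf) + q%:C ^+ (x * k.+1) *: (P`_k *m A0)).
  rewrite /lat (peval_wide _ (leqnn _)) mulmx_suml; apply: eq_bigr => k _.
  rewrite AE mulmxDr -!scalemxAl -scalemxAr scalerA -exprM -exprD.
  by rewrite mulnS addnC.
pose B := \sum_(k < size P) (mxl1 (P`_k *m Ainf) + mxl1 (P`_k *m A0)).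
have sum_le (I : finType) (G : I -> 'M[C]_2) : mxl1 (\sum_i G i) <= \sum_i mxl1 (G i).
  elim/big_ind2: _ => // [|M1 t1 M2 t2 h1 h2]; first by rewrite mxl1_0.
  exact: le_trans (mxl1D _ _) (lerD h1 h2).
have normq x k : ComplexField.Normc.normc (q%:C ^+ (x * k) : C) <= 1.
  by rewrite normcX normcR gtr0_norm// qX_le1.
have normdq x k : ComplexField.Normc.normc
    (q%:C ^+ (x.+1 * k) - q%:C ^+ (x * k) : C) <= q ^+ x.
  rewrite -!rmorphXn -rmorphB normcR ler0_norm ?opprB; last first.
    by rewrite subr_le0 mulSn exprD ler_piMl ?qX_le1// exprn_ge0 ?ltW.
  case: k => [|k]; first by rewrite !muln0 subrr exprn_ge0 ?ltW.
  rewrite lerBlDr mulnS exprD (@le_trans _ _ (q ^+ x))//.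
    by rewrite ler_piMr ?qX_le1// exprn_ge0 ?ltW.
  by rewrite lerDl exprn_ge0 ?ltW.
exists B; split.
- by apply: sumr_ge0 => k _; rewrite addr_ge0 ?mxl1_ge0.
- move=> x; rewrite latE (le_trans (sum_le _ _))// ler_sum// => k _.
  by rewrite (le_trans (mxl1D _ _))// lerD// mxl1Z ler_piMl ?mxl1_ge0.
move=> x; rewrite !latE -sumrB (le_trans (sum_le _ _))// mulr_suml ler_sum// => k _.
rewrite opprD addrACA -!scalerBl mulrDl (le_trans (mxl1D _ _))// lerD// mxl1Z mulrC.
  by rewrite ler_wpM2l ?mxl1_ge0.
by rewrite ler_wpM2l ?mxl1_ge0.
Qed.

(** In the gauged variables the middle coefficient of the operator at q^x is
q^(-x) times this constant real diagonal matrix, hence self-adjoint. *)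
Definition Delta : 'M[C]_2 :=
  mx2 (- q%:C^-1 - a%:C * q%:C) 0 0 (- 1 - a%:C).

(** The upper entry of K is the one for which the off-diagonal terms cancel. *)
Lemma conjugate_to_Delta x :
  (q%:C ^+ x *: K - Ainv - a%:C *: A) *m A ^+ x = A ^+ x *m Delta.
Proof.
rewrite exprAmx /Kmx /Ainv /Amx /Delta !mx2E; congr mx2; by field.
Qed.

Lemma lat_qdiff P x :
  q%:C ^+ x *: lat (qdiff P) x =
  (1 - q%:C ^+ x) *: lat P x.-1 + lat P x *m Delta
  + (a%:C * (1 - b%:C * q%:C ^+ x.+1)) *: lat P x.+1.
Proof.
have hA : A *m A ^+ x = A ^+ x.+1 by rewrite exprS.
have hc : a%:C - a%:C * b%:C * q%:C * q%:C ^+ x =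
    a%:C * (1 - b%:C * q%:C ^+ x.+1) :> C by rewrite exprS; ring.
have hAi : (1 - q%:C ^+ x) *:
    (peval P (q%:C^-1 * q%:C ^+ x) *m (Ainv *m A ^+ x)) =
    (1 - q%:C ^+ x) *: (peval P (q%:C ^+ x.-1) *m A ^+ x.-1).
  case: x {hA hc} => [|x]; first by rewrite expr0 subrr !scale0r.
  have -> : Ainv *m A ^+ x.+1 = A ^+ x.
    by rewrite exprS -[A * _]/(A *m _) mulmxA mulAinv_A mul1mx.
  by rewrite exprS mulKf.
rewrite /lat scalemxAl peval_qdiff !mulmxDl -!scalemxAl -!mulmxA.
by rewrite conjugate_to_Delta hA hAi hc -exprS.
Qed.

(** * The inner product *)

Definition term P S x : 'M[C]_2 := (wt x)%:C *: (lat P x *m (lat S x) ^t*).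
Local Notation W := (weight q a b v).

Lemma termE P S x : (q%:C ^+ x) *:
  (peval P (q%:C ^+ x) *m W x *m (peval S (q%:C ^+ x)) ^t*) = term P S x.
Proof.
rewrite /term /lat adjM adjX /weight -scalemxAr -scalemxAl scalerA.
have -> : q%:C ^+ x * (a ^+ x * (qpoch (b * q) q x / qpoch q q x))%:C =
    (wt x)%:C :> C by rewrite -(rmorphXn (real_complex R)) -(rmorphM (real_complex R)).
congr (_ *: _); move: (A ^+ x) ((A ^t*) ^+ x) (peval P _) ((peval S _) ^t*) => X Y p s.
by rewrite !mulmxA.
Qed.

Lemma mxcvg_qinner P S : mxcvg (series (term P S)) (qinner q W P S).
Proof.
have [B [B0 PB _]] := lat_bounds P; have [B' [B'0 SB _]] := lat_bounds S.
have [L hL] : exists L, mxcvg (series (term P S)) L.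
  apply: (@mxcvg_series _ _ _ _ ((B * B') *: wt)); last first.
    exact/is_cvg_seriesZ/cvg_series_wt.
  move=> x; rewrite mxl1Z normcR ger0_norm ?wt_ge0//.
  rewrite -[leRHS]/(B * B' * wt x) mulrC ler_wpM2r ?wt_ge0//.
  by rewrite (le_trans (mxl1M _ _))// mxl1_adj ler_pM ?mxl1_ge0.
suff -> : qinner q W P S = L by [].
rewrite -(mxcvg_lim hL) /qinner; congr (limn (series _)).
by apply/funext => x; exact: termE.
Qed.

Lemma term_adj P S x : (term P S x) ^t* = term S P x.
Proof.
rewrite /term; move: (lat P x) (lat S x) => X Y.
by rewrite adj_realZ adjM adjK.
Qed.

Lemma qinner_adj P S : (qinner q W P S) ^t* = qinner q W S P.
Proof.
apply: (mxcvg_unique _ (mxcvg_qinner S P)).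
suff -> : series (term S P) = (fun k => (series (term P S) k) ^t*).
  exact/mxcvg_adj/mxcvg_qinner.
apply/funext; elim=> [|k IH].
  by rewrite /series/= !big_geq// linear0 map_mx0.
by rewrite [LHS]seriesSr IH -term_adj [series (term P S) k.+1]seriesSr adjD.
Qed.

Lemma qinnerDl P P' S :
  qinner q W (P + P') S = qinner q W P S + qinner q W P' S.
Proof.
apply: (mxcvg_unique (mxcvg_qinner _ S)).
suff -> : series (term (P + P') S) =
    (fun k => series (term P S) k + series (term P' S) k).
  by apply: mxcvgD; exact: mxcvg_qinner.
apply/funext => k; rewrite /series/= -big_split; apply: eq_bigr => x _ /=.
by rewrite /term /lat pevalD !mulmxDl scalerDr.
Qed.

Lemma qinnerCl M P S : qinner q W (M%:P * P) S = M *m qinner q W P S.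
Proof.
apply: (mxcvg_unique (mxcvg_qinner _ S)).
suff -> : series (term (M%:P * P) S) = (fun k => M *m series (term P S) k).
  by apply: mxcvgMl; exact: mxcvg_qinner.
apply/funext => k; rewrite /series/= mulmx_sumr; apply: eq_bigr => x _ /=.
by rewrite /term /lat pevalCM -!mulmxA scalemxAr.
Qed.

(** Definiteness: the trace of each term is the weight times the sum of the
squared moduli of the entries of [lat P x], so all of them vanish; a polynomial
that vanishes at infinitely many points q^x is zero. *)
Lemma qinner_eq0 P : qinner q W P P = 0 -> P = 0.
Proof.
move=> PP0; have := mxcvg_qinner P P; rewrite PP0 => cvgP.
pose tr (M : 'M[C]_2) : R := complex.Re (M 0 0) + complex.Re (M 1 1).
pose s x := tr (term P P x).
have ReD (y z : C) : complex.Re (y + z) = complex.Re y + complex.Re z.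
  by case: y z => [? ?] [].
have sE x : s x = wt x * \sum_i \sum_j ComplexField.Normc.normc (lat P x i j) ^+ 2.
  have ReZ (c : R) (y : C) : complex.Re (c%:C * y) = c * complex.Re y.
    by case: y => y1 y2 /=; rewrite mul0r subr0.
  have normsq (y : C) : complex.Re (y * Num.conj y) = ComplexField.Normc.normc y ^+ 2.
    by rewrite -normCK norm_normc -(rmorphXn (real_complex R)).
  rewrite /s /tr /term; move: (lat P x) => X; rewrite !mxE !ReZ -mulrDr.
  congr (_ * _); rewrite !big_ord_recl !big_ord0 !addr0 !mxE !ReD !normsq.
  by congr (_ + (_ + _)); rewrite ?addr0; congr (_ (X _ _) ^+ _); apply: val_inj.
have s_ge0 x : 0 <= s x.
  rewrite sE mulr_ge0 ?wt_ge0//; do 2!(apply: sumr_ge0 => ? _).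
  by rewrite sqr_ge0.
have seriesE N : series s N = tr (series (term P P) N).
  elim: N => [|N IH]; first by rewrite /series/= !big_geq// /tr !mxE addr0.
  by rewrite !seriesSr IH /s /tr !mxE !ReD addrACA.
have cvgs : series s @ \oo --> (0 : R).
  apply: (squeeze0 _ (cvg0Ml 2 cvgP)) => N.
  rewrite sumr_ge0//= subr0 seriesE /tr mulr2n mulrDl mul1r lerD//.
    by rewrite (le_trans (ler_norm _))// (le_trans (normc_Re _))// mxl1_entry.
  by rewrite (le_trans (ler_norm _))// (le_trans (normc_Re _))// mxl1_entry.
have s0 x : s x = 0.
  apply/eqP; rewrite eq_le s_ge0 andbT.
  have homo : {homo series s : n m / (n <= m)%N >-> n <= m}.
    by apply/nondecreasing_seqP => n; rewrite seriesSr lerDl.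
  have cs : cvgn (series s) by apply/cvg_ex; exists 0.
  have := nondecreasing_cvgn_le homo cs x.+1.
  rewrite (cvg_lim _ cvgs)// seriesSr; apply: le_trans.
  by rewrite lerDr sumr_ge0.
have lat0 x : lat P x = 0.
  have /eqP := s0 x; rewrite sE mulf_eq0 gt_eqF/=; last first.
    by rewrite mulr_gt0 ?exprn_gt0 ?cwt_gt0.
  rewrite psumr_eq0; last by move=> i _; apply: sumr_ge0 => j _; rewrite sqr_ge0.
  move=> /allP h; apply/matrixP => i j.
  have := h i (mem_index_enum _); rewrite psumr_eq0; last by move=> ? _; rewrite sqr_ge0.
  move=> /allP /(_ j (mem_index_enum _)); rewrite sqrf_eq0 => /eqP.
  by move/ComplexField.Normc.eq0_normc => ->; rewrite mxE.
apply: (@peval_eq0 R P (fun x => q%:C ^+ x)) => [x y|x].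
  rewrite -!(rmorphXn (real_complex R)) => /complexI/eqP.
  have [xy|yx|//] := ltngtP x y.
    by rewrite gt_eqF// ltr_iXn2l.
  by rewrite lt_eqF// ltr_iXn2l.
have AA : A ^+ x *m Ainv ^+ x = 1%:M.
  elim: x => [|x IH]; first by rewrite !expr0 mulmx1.
  rewrite exprSr exprS -![_ * _]/(_ *m _) mulmxA -(mulmxA _ A).
  by rewrite mulA_Ainv mulmx1.
by rewrite -[LHS]mulmx1 -AA mulmxA -/(lat P x) lat0 mul0mx.
Qed.

(** * Symmetry of the difference operator *)

(** The discrete Wronskian left over by summation by parts. *)
Definition bdry P S x : 'M[C]_2 := (cwt x * (1 - q ^+ x))%:C *:
  (lat P x *m (lat S x.-1) ^t* - lat P x.-1 *m (lat S x) ^t*).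

Lemma bdry0 P S : bdry P S 0 = 0.
Proof. by rewrite /bdry expr0 subrr mulr0 scale0r. Qed.

Lemma Delta_adj : Delta ^t* = Delta.
Proof.
have -> : Delta = mx2 (- q^-1 - a * q)%:C 0 0 (- 1 - a)%:C.
  rewrite /Delta; congr mx2.
    by rewrite rmorphB rmorphN fmorphV rmorphM.
  by rewrite rmorphB rmorphN rmorph1.
apply: matrix2P; rewrite !mxE /=; try exact: conjc_real; exact: conjC0.
Qed.

Lemma term_qdiff P S x :
  term (qdiff P) S x - term P (qdiff S) x = bdry P S x.+1 - bdry P S x.
Proof.
have wtC : (wt x)%:C = (cwt x)%:C * q%:C ^+ x :> C.
  by rewrite -(rmorphXn (real_complex R)) -(rmorphM (real_complex R)) mulrC.
have -> : term (qdiff P) S x = (cwt x)%:C *: ((q%:C ^+ x *: lat (qdiff P) x) *m (lat S x) ^t*).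
  by rewrite /term wtC -scalerA -scalemxAl.
have -> : term P (qdiff S) x = (cwt x)%:C *: (lat P x *m (q%:C ^+ x *: lat (qdiff S) x) ^t*).
  by rewrite /term wtC -(rmorphXn (real_complex R)) adj_realZ -scalerA -scalemxAr.
rewrite !lat_qdiff.
have -> : 1 - q%:C ^+ x = (1 - q ^+ x)%:C :> C.
  by rewrite rmorphB rmorph1 rmorphXn.
have -> : a%:C * (1 - b%:C * q%:C ^+ x.+1) = (a * (1 - b * q ^+ x.+1))%:C :> C.
  by rewrite rmorphM rmorphB rmorph1 rmorphM rmorphXn.
by rewrite (discrete_green _ _ _ _ _ _ _ _ _ Delta_adj) -cwtS.
Qed.

(** The scalar weight need not tend to zero, only q^x times it does; the missing
factor q^x comes from the increments of the gauged values. *)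
Lemma bdry_cvg0 P S : mxcvg (bdry P S) 0.
Proof.
have [B [B0 PB dPB]] := lat_bounds P; have [B' [B'0 SB dSB]] := lat_bounds S.
apply: (mxcvg_squeeze _ (cvg0Ml (2 * B * B' / q) wt_cvg0)) => -[|x].
  by rewrite bdry0 subr0 mxl1_0 mulr_ge0 ?wt_ge0// divr_ge0 ?(ltW q0)// !mulr_ge0.
rewrite subr0 /bdry/= mxl1Z normcR.
have swap (M M' N N' : 'M[C]_2) : M' *m N ^t* - M *m N' ^t* =
    (M' - M) *m N ^t* - M *m (N' - N) ^t*.
  by rewrite adjD adjN mulmxBl mulmxBr opprB addrA subrK.
have qx1 : 0 < 1 - q ^+ x.+1 by rewrite subr_gt0 qX_lt1.
rewrite ger0_norm; last by rewrite mulr_ge0 ?ltW ?cwt_gt0.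
have -> : 2 * B * B' / q * wt x.+1 = cwt x.+1 * (B * q ^+ x * B' + B * (B' * q ^+ x)).
  by rewrite /wt exprS; field; rewrite gt_eqF.
rewrite -[leLHS]mulrA ler_pM2l ?cwt_gt0// (le_trans (ler_piMl _ _)) ?mxl1_ge0//.
  by rewrite gerBl exprn_ge0 ?ltW.
rewrite swap (le_trans (mxl1D _ _))// mxl1N lerD//.
  by rewrite (le_trans (mxl1M _ _))// mxl1_adj ler_pM ?mxl1_ge0.
by rewrite (le_trans (mxl1M _ _))// mxl1_adj ler_pM ?mxl1_ge0.
Qed.

Lemma qdiff_sym P S : qinner q W (qdiff P) S = qinner q W P (qdiff S).
Proof.
apply/eqP; rewrite -subr_eq0; apply/eqP.
have h := mxcvgD (mxcvg_qinner (qdiff P) S) (mxcvgN (mxcvg_qinner P (qdiff S))).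
apply: (mxcvg_unique h).
suff -> : (fun k => series (term (qdiff P) S) k - series (term P (qdiff S)) k)
    = bdry P S by exact: bdry_cvg0.
apply/funext => k; rewrite /series/= -sumrB.
rewrite (eq_bigr (fun x => bdry P S x.+1 - bdry P S x)); last first.
  by move=> x _; exact: term_qdiff.
by rewrite (telescope_sumr _ (leq0n k)) bdry0 subr0.
Qed.

(** * The eigenvalue equation *)

(** Every polynomial of degree less than n is a left combination of P_0, ...,
P_(n-1). *)
Lemma qinner_low (P : nat -> {poly 'M[C]_2}) : monic_orthogonal q W P ->
  forall n S, (size S <= n)%N -> qinner q W S (P n) = 0.
Proof.
move=> [Psz Porth] n S Sn.
suff H m : (m <= n)%N -> forall S, (size S <= m)%N -> qinner q W S (P n) = 0.
  exact: (H n).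
elim: m => [|m IH] mn {Sn}S Sm.
  move: Sm; rewrite leqn0 size_poly_eq0 => /eqP ->.
  by rewrite -[X in qinner _ _ X _](mulr0 (0%:P)) qinnerCl mul0mx.
have [Pm_size Pm_lead] := Psz m.
have -> : S = (S`_m)%:P * P m + (S - (S`_m)%:P * P m) by rewrite addrC subrK.
rewrite qinnerDl qinnerCl Porth; last by apply/eqP; rewrite ltn_eqF.
rewrite mulmx0 add0r IH ?(ltnW mn)//; apply/leq_sizeP => j.
rewrite leq_eqVlt => /orP[/eqP <-|mj]; rewrite coefB coefCM.
  have -> : (P m)`_m = 1 by rewrite -Pm_lead lead_coefE Pm_size.
  by rewrite mulr1 subrr.
by rewrite [S`_j]nth_default ?(leq_trans Sm)// [(P m)`_j]nth_default ?Pm_size// mulr0 subr0.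
Qed.

(** The operator does not raise degrees and is symmetric, so the difference S of
the two sides has degree less than n and is orthogonal to itself. *)
Lemma qdiff_eigen (P : nat -> {poly 'M[C]_2}) : monic_orthogonal q W P ->
  forall n, qdiff (P n) = (Bcoef n)%:P * P n.
Proof.
move=> hP n; have [Pn_size Pn_lead] := hP.1 n.
have Pnn : (P n)`_n = 1 by rewrite -Pn_lead lead_coefE Pn_size.
pose S := qdiff (P n) + (- Bcoef n)%:P * P n.
have Sn : (size S <= n)%N.
  apply/leq_sizeP => j nj; rewrite /S coefD coefCM coef_qdiff.
  rewrite [(P n)`_j.+1]nth_default ?Pn_size// mul0mx addr0.
  move: nj; rewrite leq_eqVlt => /orP[/eqP <-|nj].
    by rewrite Pnn mul1mx mulr1 subrr.
  by rewrite nth_default ?Pn_size// mul0mx mulr0 addr0.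
have low (T : {poly 'M[C]_2}) : (size T <= n)%N -> qinner q W (P n) T = 0.
  by move=> Tn; rewrite -qinner_adj (qinner_low hP)// trmx0 map_mx0.
suff : S = 0.
  by move/eqP; rewrite /S polyCN mulNr subr_eq0 => /eqP.
apply: qinner_eq0; rewrite {1}/S qinnerDl qinnerCl qdiff_sym.
by rewrite !low ?mulmx0 ?addr0// (leq_trans (size_poly _ _)).
Qed.

Lemma qdiffCM M P : qdiff (M%:P * P) = M%:P * qdiff P.
Proof.
by apply/polyP => k; rewrite coefCM !coef_qdiff !coefCM mulrDr -![_ * _]/(_ *m _) !mulmxA.
Qed.

Definition lambda_mx n : 'M[C]_2 := mx2 (lambda q a b 0 n) 0 0 (lambda q a b 1 n).

(** The entry alpha_n is the quotient of the off-diagonal entry of Bcoef n by the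
difference of the two eigenvalues. *)
Lemma Nmx_Bcoef n : Nmx q a b v n *m Bcoef n = lambda_mx n *m Nmx q a b v n.
Proof.
have l0 : lambda q a b 0 n =
    - ((q%:C ^+ n)^-1 / q%:C) - a%:C * b%:C * (q%:C ^+ n * q%:C ^+ 2).
  rewrite /lambda /= rmorphB rmorphN !rmorphM fmorphV !rmorphXn exprD.
  by rewrite [in LHS]exprSr invfM.
have l1 : lambda q a b 1 n = - (q%:C ^+ n)^-1 - a%:C * b%:C * (q%:C ^+ n * q%:C).
  by rewrite /lambda /= -exprSr rmorphB rmorphN !rmorphM fmorphV !rmorphXn.
have al : alpha q a b v n = v * ((1 - q%:C ^+ n + a%:C * (q%:C ^+ n * q%:C)
      - a%:C * b%:C * (q%:C ^+ n * q%:C) ^+ 2)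
    / (1 - a%:C * b%:C * (q%:C ^+ n * q%:C) ^+ 2)).
  have E : q ^+ (2 * n + 2) = (q ^+ n * q) ^+ 2.
    by rewrite -exprSr -exprM muln2 doubleS -mul2n addn2.
  rewrite /alpha E exprSr; congr (_ * _).
  by rewrite !(fmorphV, rmorphB, rmorphD, rmorphM, rmorphXn, rmorph1).
have ab0 : 1 - a%:C * b%:C * (q%:C ^+ n * q%:C) ^+ 2 != 0 :> C.
  have h := one_sub_abq_gt0 (n * 2).
  rewrite -exprSr -exprM muln2 doubleS -muln2.
  rewrite -(rmorphXn (real_complex R)) -!(rmorphM (real_complex R)).
  by rewrite -(rmorph1 (real_complex R)) -(rmorphB (real_complex R)) fmorph_eq0 gt_eqF.
rewrite /Nmx /Bcoef /lambda_mx l0 l1 al /Kmx /Ainv /Amx [q%:C ^+ n.+1]exprSr !mx2E.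
have : q%:C ^+ n != 0 :> C by rewrite expf_neq0.
move: ab0; move: (q%:C ^+ n) => Qn ab0 Qn0.
congr mx2; field; rewrite ?qC0 ?Qn0 ?ab0//.
Qed.

Lemma qdiff_Ptilde (P : nat -> {poly 'M[C]_2}) n : monic_orthogonal q W P ->
  qdiff (Ptilde q a b v P n) = (lambda_mx n)%:P * Ptilde q a b v P n.
Proof.
move=> hP; rewrite /Ptilde qdiffCM (qdiff_eigen hP) !mulrA -!polyCM.
by rewrite -[_ * Bcoef n]/(_ *m Bcoef n) Nmx_Bcoef.
Qed.

Lemma row_lambda_mx n (M : 'M[C]_2) i :
  row i (lambda_mx n *m M) = lambda q a b i n *: row i M.
Proof.
apply/rowP => j; rewrite !mxE !big_ord_recl big_ord0 !mxE /=.
by case: i => [[|[|//]] hi]; rewrite /lambda /= ?mul0r ?addr0 ?add0r;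
  congr (_ * M _ _); apply: val_inj.
Qed.

Lemma row_difference_equation (P : {poly 'M[C]_2}) (l : C) i z :
  row i (peval (qdiff P) z) = l *: row i (peval P z) ->
  (1 - z) *: row i (peval P (q%:C^-1 * z))
  + row i (peval P z) *m (z *: ((K - l%:M) *m A) - (1%:M + a%:C *: A ^+ 2))
  + row i (peval P (q%:C * z)) *m ((a%:C - a%:C * b%:C * q%:C * z) *: A ^+ 2) = 0.
Proof.
have rowD X Y : row i (X + Y : 'M[C]_2) = row i X + row i Y by exact: linearD.
have rowZ c X : row i (c *: X : 'M[C]_2) = c *: row i X by exact: linearZ.
move=> Pl; rewrite -[A ^+ 2]/(A *m A); apply: (clear_inverse mulAinv_A Pl).
by rewrite -rowZ peval_qdiff !rowD !rowZ !row_mul.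
Qed.

(** * Coefficients of the eigenfunctions *)

Lemma row_recurrence (P : {poly 'M[C]_2}) (l : C) i k :
  row i (qdiff P)`_k = l *: row i P`_k ->
  (1%:M - q%:C ^+ k.+1 *: (a%:C *: A ^+ 2)) \in unitmx ->
  row i P`_k.+1 = (q%:C / (1 - q%:C ^+ k.+1)) *: (row i P`_k *m
    (1%:M - q%:C ^+ k *: (K *m A - l *: A)
      - q%:C ^+ (2 * k) *: (- (a%:C * b%:C * q%:C) *: A ^+ 2))
    *m invmx (1%:M - q%:C ^+ k.+1 *: (a%:C *: A ^+ 2))).
Proof.
have rowD X Y : row i (X + Y : 'M[C]_2) = row i X + row i Y by exact: linearD.
rewrite coef_qdiff rowD !row_mul /Bcoef /Ccoef -[A ^+ 2]/(A *m A) mulnC exprM exprS.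
have qk0 : q%:C ^+ k != 0 :> C by rewrite expf_neq0.
have qk1 : 1 - q%:C * q%:C ^+ k != 0 :> C.
  rewrite -exprS -(rmorphXn (real_complex R)) -(rmorph1 (real_complex R)).
  by rewrite -(rmorphB (real_complex R)) fmorph_eq0 gt_eqF// subr_gt0 qX_lt1.
move=> E Uu; exact: coef_recurrence mulAinv_A Uu E.
Qed.

Lemma unit_denominator k : (1%:M - q%:C ^+ k.+1 *: (a%:C *: A ^+ 2)) \in unitmx.
Proof.
have nz m : 1 - q%:C ^+ k.+1 * (a%:C * q%:C ^+ m) != 0 :> C.
  rewrite mulrCA -exprD -(rmorphXn (real_complex R)) -(rmorphM (real_complex R)).
  rewrite -(rmorph1 (real_complex R)) -(rmorphB (real_complex R)) fmorph_eq0.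
  by rewrite addSn gt_eqF// one_sub_aq_gt0.
rewrite exprAmx !mx2E; have := nz 2%N; have := nz 0%N; rewrite expr0 mulr1.
move: (_ ^+ k.+1) (q%:C ^+ 2) => t Q2 x0 y0.
by rewrite !mulr0 subrr; exact: mx2_upper_unit.
Qed.

(** Iterating the recurrence identifies the monomials of an eigenfunction with
the terms of the series at q z. *)
Lemma coef_eta (P : {poly 'M[C]_2}) (l : C) i :
  (forall k, row i (qdiff P)`_k = l *: row i P`_k) ->
  forall k z, z ^+ k *: row i P`_k = row i P`_0 *m eta_term q
    (K *m A - l *: A) (- (a%:C * b%:C * q%:C) *: A ^+ 2) (a%:C *: A ^+ 2) (q%:C * z) k.
Proof.
move=> Pl k z; elim: k => [|k IH].
  by rewrite /eta_term !expr0 /qpoch big_ord0 divr1 !scale1r mulmx1.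
rewrite (row_recurrence (Pl k) (unit_denominator k)) [eta_term _ _ _ _ _ k.+1]eta_termS.
rewrite -scalemxAr mulmxA mulmxA -IH -!scalemxAl !scalerA; congr (_ *: _).
by rewrite exprS; ring.
Qed.
End DifferenceOperator.

(** * The rows of N_n P_n as q-hypergeometric functions *)

Theorem proposition5p7 (R : realType) (q a b : R) (v : R[i])
    (hq : 0 < q < 1) (ha : 0 < a < q^-1) (hb : b < q^-1)
    (P : nat -> {poly 'M[R[i]]_2})
    (hP : monic_orthogonal q (weight q a b v) P) :
  let A := Amx q v in
  let K := Kmx q a v in
  forall (i : 'I_2) (n : nat),
  let p := Ptilde_row q a b v P i n in
  let l := lambda q a b i n in
  (forall z : R[i],
     (1 - z) *: p (q%:C^-1 * z)
     + p z *m (z *: ((K - l%:M) *m A) - (1%:M + a%:C *: A ^+ 2))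
     + p (q%:C * z) *m ((a%:C - a%:C * b%:C * q%:C * z) *: A ^+ 2) = 0)
  /\
  (forall z : R[i], `|q%:C * z| < 1 ->
     p z = p 0 *m eta21 (K *m A - l *: A) (- (a%:C * b%:C * q%:C) *: A ^+ 2)
                        (a%:C *: A ^+ 2) q%:C (q%:C * z)).
Proof.
move=> A K i n p l.
have eigen := qdiff_Ptilde hq ha hb n hP.
set Pt := Ptilde q a b v P n in eigen.
split=> z.
  apply: (row_difference_equation (b := b) hq); rewrite -/Pt.
  by rewrite eigen pevalCM row_lambda_mx.
rewrite norm_normc ltcR => qz1.
have coefE k : row i (qdiff q a b v Pt)`_k = l *: row i Pt`_k.
  by rewrite eigen coefCM -row_lambda_mx.
have [L cvgL] := eta_cvg (K *m A - l *: A) (- (a%:C * b%:C * q%:C) *: A ^+ 2)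
  hq (unit_denominator v hq ha) qz1.
have -> : eta21 (K *m A - l *: A) (- (a%:C * b%:C * q%:C) *: A ^+ 2)
    (a%:C *: A ^+ 2) q%:C (q%:C * z) = L by exact: mxcvg_lim cvgL.
have p0E : p 0 = row i Pt`_0.
  by rewrite /p /Ptilde_row -/Pt /peval raddf0 horner_coef0.
have := mxcvg_shift (size Pt) (mxcvgMl (p 0) cvgL).
suff -> : (fun k => p 0 *m series (eta_term q (K *m A - l *: A)
    (- (a%:C * b%:C * q%:C) *: A ^+ 2) (a%:C *: A ^+ 2) (q%:C * z)) (size Pt + k)%N)
    = fun=> p z.
  by move=> h; exact: mxcvg_unique (mxcvg_cst _) h.
apply/funext => k; rewrite p0E /series/= mulmx_sumr.
under eq_bigr do rewrite -(coef_eta hq ha coefE).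
rewrite big_mkord /p /Ptilde_row -/Pt (peval_wide _ (leq_addr k (size Pt))).
by rewrite raddf_sum/=; apply: eq_bigr => j _; rewrite linearZ.
Qed.
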